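(* Let $f:\mathbb{N}\to\mathbb{C}$ be essentially bounded. Let $x$ range over positive integers and let $h=h(x)$, $H=H(x)$, $Q=Q(x)$ be positive integers with $h\le H<Q$, $Q\ll x$ and $H=o(x)$ as $x\to\infty$. Let $g:\mathbb{N}\to\mathbb{C}$ be a sieve function of range $Q$ with Eratosthenes transform $g'$. Then for every $\varepsilon>0$, as $x\to\infty$, $$\sum_{1\le a\le H}\ \sum_{x<n\le x+h}f(n)g(n-a)=\Big(\sum_{1\le a\le H}g(x-a)\Big)\Big(\sum_{x<n\le x+h}f(n)\Big)+O_{\varepsilon}\big(x^{\varepsilon}h^2\big)$$ $$+\Big(H\sum_{q\le h}\frac{g'(q)}{q}\Big)\sum_{x<n\le x+h}f(n)+\sum_{1\le a\le H}\ \sum_{h<q\le H}g'(q)\sum_{\substack{x<n\le x+h\\ n\equiv a \bmod q}}f(n)-\Big(\sum_{1\le a\le H}\ \sum_{\substack{q\le H\\ q\mid x-a}}g'(q)\Big)\sum_{x<n\le x+h}f(n).$$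
   Context: An arithmetic function $f:\mathbb{N}\to\mathbb{C}$ is essentially bounded if for every $\varepsilon>0$, $f(n)\ll_\varepsilon n^\varepsilon$ as $n\to\infty$. A function $g:\mathbb{N}\to\mathbb{C}$ is a sieve function of range $Q$ if $g(n)=\sum_{q\mid n,\,q\le Q}g'(q)$ for all $n$, where $g'=g\ast\mu$ (Dirichlet convolution with the Möbius function), called the Eratosthenes transform of $g$, is supported on $[1,Q]$ and satisfies $g'(q)\ll_\varepsilon q^\varepsilon$ for every $\varepsilon>0$. Sums over $q$ run over positive integers. The implied $O_\varepsilon$-constant depends only on $\varepsilon$ and the fixed data, not on $x,h,H,Q$. *)

(* Defs.v *)
From mathcomp Require Import all_boot all_order all_algebra.
From mathcomp Require Import all_classical all_reals all_analysis.
From mathcomp Require Export complex.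

Set Implicit Arguments.
Unset Strict Implicit.
Unset Printing Implicit Defensive.

Import Order.TTheory GRing.Theory Num.Theory.
Import numFieldNormedType.Exports.

Local Open Scope classical_set_scope.
Local Open Scope ring_scope.
Local Open Scope complex_scope.

(* Arithmetic functions live on the positive integers: they are encoded as
   functions on nat whose value at 0 is irrelevant. *)

(* Only meaningful for n > 0. *)
Definition mobius (n : nat) : int :=
  if all (fun p => logn p n == 1%N) (primes n)
  then (-1) ^+ size (primes n) else 0.

Definition dirichlet (A : pzRingType) (u v : nat -> A) (n : nat) : A :=
  \sum_(d <- divisors n) u d * v (n %/ d)%N.

Definition eratosthenes (A : pzRingType) (g : nat -> A) : nat -> A :=
  dirichlet g (fun n => (mobius n)%:~R).

Definition essentially_bounded (R : realType) (f : nat -> R[i]) : Prop :=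
  forall e : R, 0 < e -> (f : nat -> R[i]^o) =O_\oo (fun n : nat => (n%:R `^ e)%:C : R[i]^o).

(* K e is the implied constant in g'(q) <<_e q^e. It is a parameter so that
   one K can serve a whole family of sieve functions of varying range. *)
Definition sieve_function (R : realType) (K : R -> R) (Q : nat)
    (g : nat -> R[i]) : Prop :=
  [/\ forall n, (0 < n)%N ->
        g n = \sum_(1 <= q < Q.+1 | (q %| n)%N) eratosthenes g q,
      forall q, (Q < q)%N -> eratosthenes g q = 0
    & forall e : R, 0 < e -> forall q, (0 < q)%N ->
        `|eratosthenes g q| <= (K e * q%:R `^ e)%:C].

(* Main.v *)
(* Split g(n - a) over the divisors q <= h, h < q <= H and H < q <= Q. The
   middle range is one of the main terms. For q <= h, the number of a <= H with
   q | n - a differs from H/q by at most 1. For H < q, let D(m) be the sum of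
   g'(q) over the divisors q > H of m, and G(y) the sum of D(y - a) over a <= H:
   since G(y + 1) - G(y) = D(y) - D(y - H), replacing n by x costs at most
   2h max |D|, which is O(h x^e) by the divisor bound. *)
Require Import Defs.
From mathcomp Require Import all_boot all_order all_algebra.
From mathcomp Require Import all_classical all_reals all_analysis.
From mathcomp Require Import complex.
From mathcomp Require Import zify ring lra.

Import Order.TTheory GRing.Theory Num.Theory.
Import numFieldNormedType.Exports.

Local Open Scope classical_set_scope.

Set Implicit Arguments.
Unset Strict Implicit.
Unset Printing Implicit Defensive.

(** * Elementary bounds for the number of divisors *)

(** Any [d] dividing [m * n] is [gcdn d m] times a divisor of [n], so the products of pairs of
    divisors cover all of [divisors (m * n)]. *)
Lemma size_divisors_mul m n : 0 < m -> 0 < n ->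
  size (divisors (m * n)) <= size (divisors m) * size (divisors n).
Proof.
move=> m0 n0.
rewrite -(size_allpairs muln); apply: uniq_leq_size; first exact: divisors_uniq.
move=> d; rewrite -dvdn_divisors ?muln_gt0 ?m0// => dmn.
have gm : gcdn d m %| m by apply: dvdn_gcdr.
have g0 : 0 < gcdn d m by rewrite gcdn_gt0 m0 orbT.
apply/allpairsP; exists (gcdn d m, d %/ gcdn d m) => /=; split.
- by rewrite -dvdn_divisors.
- rewrite -dvdn_divisors// -(@dvdn_pmul2r (gcdn d m))// divnK ?dvdn_gcdl//.
  by rewrite muln_gcdr dvdn_gcd dvdn_mull//= mulnC.
- by rewrite mulnC divnK// dvdn_gcdl.
Qed.

Lemma size_divisors_pfactor p a : prime p -> size (divisors (p ^ a)) <= a.+1.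
Proof.
move=> pp; have <- : size (map (expn p) (iota 0 a.+1)) = a.+1 by rewrite size_map size_iota.
apply: uniq_leq_size; first exact: divisors_uniq.
move=> d; rewrite -dvdn_divisors ?expn_gt0 ?prime_gt0// => /(dvdn_pfactor _ _ pp)[b ba ->].
by apply: map_f; rewrite mem_iota.
Qed.

(** With [b = a %/ k], [a + 1 <= k * (b + 1) <= k * 2 ^ b]; then take [k]-th powers and use
    [b * k <= a]. *)
Lemma expS_leq_expn2 k a : 0 < k -> a.+1 ^ k <= k ^ k * 2 ^ a.
Proof.
move=> k0; apply: (@leq_trans ((k * 2 ^ (a %/ k)) ^ k)).
  rewrite leq_exp2r//; apply: (@leq_trans (k * (a %/ k).+1)).
    by rewrite mulnC -ltn_divLR.
  by rewrite leq_mul2l ltn_expl// orbT.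
by rewrite expnMn -expnM leq_mul2l leq_exp2l// leq_divM orbT.
Qed.

(* Primes below [2 ^ k] each cost a factor [k ^ k]; the larger ones satisfy
   [(a + 1) ^ k <= 2 ^ (k a) <= p ^ a] and cost nothing. *)
Lemma size_divisors_exp_leq_part k N n : 0 < k -> 0 < n ->
  (forall p, p \in primes n -> p < N) ->
  size (divisors n) ^ k <= (k ^ k) ^ minn N (2 ^ k) * n.
Proof.
move=> k0; elim: N n => [|N IH] n n0 hn.
  have : primes n = [::].
    by case: (primes n) hn => [//|p s] /(_ p); rewrite mem_head ltn0 => /(_ isT).
  move/eqP; rewrite primes_eq0 => n1; have -> : n = 1 by lia.
  by rewrite muln1 exp1n expn_gt0 expn_gt0 k0.
have kk0 : 0 < k ^ k by rewrite expn_gt0 k0.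
have [pN|npN] := boolP (prime N); last first.
  apply: leq_trans (IH n n0 _) _.
    move=> p pn; have := hn _ pn; rewrite ltnS leq_eqVlt => /orP[/eqP pN|//].
    by move: pn npN; rewrite mem_primes pN => /andP[->].
  by rewrite leq_mul2r leq_pexp2l ?orbT//; lia.
set a := logn N n.
have nE : n = N ^ a * n`_(negn N) by rewrite -p_part partnC.
have m0 : 0 < n`_(negn N) by apply: part_gt0.
have Na0 : 0 < N ^ a by rewrite expn_gt0 prime_gt0.
have {}IH := IH _ m0 _.
rewrite {1}nE.
apply: (@leq_trans ((a.+1 * size (divisors n`_(negn N))) ^ k)).
  rewrite leq_exp2r//; apply: leq_trans (size_divisors_mul Na0 m0) _.
  by rewrite leq_mul2r size_divisors_pfactor ?orbT.
rewrite expnMn.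
have {}IH : size (divisors n`_(negn N)) ^ k <= (k ^ k) ^ minn N (2 ^ k) * n`_(negn N).
  apply: IH => p; rewrite primes_part mem_filter => /andP[pN' pn].
  by have := hn _ pn; rewrite ltnS leq_eqVlt => /orP[/eqP pE|//]; rewrite pE inE/= inE eqxx in pN'.
have [Nk|Nk] := ltnP N (2 ^ k).
  have -> : minn N.+1 (2 ^ k) = (minn N (2 ^ k)).+1 by lia.
  rewrite expnS {2}nE; apply: leq_trans (leq_mul (expS_leq_expn2 a k0) IH) _.
  have : 2 ^ a <= N ^ a by case: (a) => // b; rewrite leq_exp2r// prime_gt1.
  by move=> ?; rewrite mulnACA leq_mul2l leq_mul2r; apply/orP; right; apply/orP; right.
have -> : minn N.+1 (2 ^ k) = minn N (2 ^ k) by lia.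
rewrite {2}nE mulnCA; apply: leq_mul IH.
apply: (@leq_trans ((2 ^ a) ^ k)); first by rewrite leq_exp2r// ltn_expl.
by rewrite -expnM mulnC expnM; case: (a) => // b; rewrite leq_exp2r.
Qed.

(** An integer form of the bound of order [n ^ (1 / k)]: all prime factors lie below [n + 1], and
    the exponent is capped at [2 ^ k] independently of [n]. *)
Lemma size_divisors_exp_leq k n : 0 < k -> 0 < n ->
  size (divisors n) ^ k <= (k ^ k) ^ (2 ^ k) * n.
Proof.
move=> k0 n0; apply: leq_trans (@size_divisors_exp_leq_part k n.+1 n k0 n0 _) _.
  by move=> p; rewrite mem_primes => /and3P[_ _ /dvdn_leq]; rewrite ltnS; apply.
by rewrite leq_mul2r leq_pexp2l ?geq_minr ?orbT// expn_gt0 k0.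
Qed.

Local Open Scope ring_scope.
Local Open Scope complex_scope.

(** * Divisor sums over a range, and their sums over a window of shifts *)

Definition divisor_sum (V : nmodType) (u : nat -> V) (lo hi m : nat) : V :=
  \sum_(lo.+1 <= q < hi.+1 | (q %| m)%N) u q.

Lemma divisor_sum_cat (V : nmodType) (u : nat -> V) lo mid hi m :
  (lo <= mid <= hi)%N ->
  divisor_sum u lo hi m = divisor_sum u lo mid m + divisor_sum u mid hi m.
Proof. by case/andP=> ? ?; rewrite /divisor_sum (big_cat_nat _ (n := mid.+1)). Qed.

Lemma norm_divisor_sum_le (F : numDomainType) (u : nat -> F) (B : F) lo hi m :
  (0 < m)%N -> (forall q, (0 < q <= hi)%N -> `|u q| <= B) -> 0 <= B ->
  `|divisor_sum u lo hi m| <= B *+ size (divisors m).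
Proof.
move=> m0 uB B0; apply: le_trans (ler_norm_sum _ _ _) _.
apply: (@le_trans _ _ (\sum_(lo.+1 <= q < hi.+1 | (q %| m)%N) B)).
  rewrite big_nat_cond [leRHS]big_nat_cond; apply: ler_sum => q /andP[/andP[q1 q2] _].
  by apply: uB; lia.
rewrite big_const_seq iter_addr_0 ler_wpMn2l// -size_filter.
apply: uniq_leq_size; first by rewrite filter_uniq// iota_uniq.
by move=> q; rewrite mem_filter -dvdn_divisors// => /andP[].
Qed.

(** Multiples of [q] in [[n - H, n - 1]] are counted by a difference of two floors, written
    additively because subtraction on [nat] truncates. *)
Lemma count_dvdn_sub n H q : (0 < q)%N -> (H < n)%N ->
  (\sum_(1 <= a < H.+1 | q %| n - a) 1 + (n - H).-1 %/ q = n.-1 %/ q)%N.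
Proof.
move=> q0; elim: H => [|H IH] Hn; first by rewrite big_geq// subn0.
rewrite big_mkcond big_nat_recr//= -big_mkcond/= -addnA -IH ?(ltnW Hn)//; congr addn.
have -> : (n - H).-1 = (n - H.+1).-1.+1 by lia.
rewrite divnS//; congr addn.
by have -> : ((n - H.+1).-1.+1 = n - H.+1)%N by lia.
Qed.

(** Multiplied by [q], the difference becomes one of two remainders modulo [q], hence is at most [q]
    in absolute value. *)
Lemma dist_count_dvdn_sub_le1 (F : numFieldType) n H q : (0 < q)%N -> (H < n)%N ->
  `|(\sum_(1 <= a < H.+1 | (q %| n - a)%N) 1)%N%:R - H%:R / q%:R| <= 1 :> F.
Proof.
move=> q0 Hn; have := count_dvdn_sub q0 Hn; set c := bigop.body _ _ _ => cE.
have q0F : 0 < q%:R :> F by rewrite ltr0n.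
rewrite -(ler_pM2r q0F) mul1r -[X in _ * X](gtr0_norm q0F) -normrM.
rewrite mulrBl divfK ?gt_eqF// real_ler_norml ?rpredB ?rpredM ?rpred_nat//.
have := divn_eq n.-1 q; have := divn_eq (n - H).-1 q.
have := ltn_pmod n.-1 q0; have := ltn_pmod (n - H).-1 q0.
rewrite -cE => ? ? ? ?.
by rewrite lerNl opprB !lerBlDr -!natrM -!natrD !ler_nat; apply/andP; split; nia.
Qed.

Lemma sliding_sum_dist_le (F : numDomainType) (D : nat -> F) (T : F) (x H k : nat) :
  (H < x)%N -> (forall m, (0 < m < x + k)%N -> `|D m| <= T) ->
  `|\sum_(1 <= a < H.+1) D (x + k - a)%N - \sum_(1 <= a < H.+1) D (x - a)%N|
     <= T *+ (2 * k).
Proof.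
move=> Hx; elim: k => [|k IH] DT; first by rewrite addn0 subrr normr0 muln0.
rewrite -(subrK (\sum_(1 <= a < H.+1) D (x + k - a)%N) (\sum_(1 <= a < H.+1) D (x + k.+1 - a)%N)).
rewrite -addrA; apply: le_trans (ler_normD _ _) _.
rewrite mulnS mulrnDr; apply: lerD; last first.
  by apply: IH => m mxk; apply: DT; lia.
have -> : \sum_(1 <= a < H.+1) D (x + k.+1 - a)%N - \sum_(1 <= a < H.+1) D (x + k - a)%N
  = D (x + k)%N - D (x + k - H)%N.
  have -> : \sum_(1 <= a < H.+1) D (x + k.+1 - a)%N = \sum_(0 <= a < H) D (x + k - a)%N.
    by rewrite big_add1/=; apply: eq_bigr => a _; congr D; lia.
  (* Both sides sum [D] over the [H + 1] arguments from [x + k - H] to [x + k], with one end or the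
     other split off. *)
  have E : \sum_(0 <= a < H) D (x + k - a)%N + D (x + k - H)%N =
      D (x + k)%N + \sum_(1 <= a < H.+1) D (x + k - a)%N.
    by rewrite -big_nat_recr// [LHS]big_ltn// subn0.
  by apply/eqP; rewrite subr_eq addrAC eq_sym subr_eq -E.
apply: le_trans (ler_normB _ _) _.
by rewrite mulr2n; apply: lerD; apply: DT; lia.
Qed.

(** * The decomposition with an explicit error *)

(** Each of the [h] values of [n] costs at most [A] times [B * h] from the divisors [q <= h] plus
    [2 * h * B * V] from those above [H]. *)
Lemma sieve_correlation_bound (F : numFieldType) (f g u : nat -> F) (x h H Q V : nat)
    (A B : F) :
  (h <= H)%N -> (H <= Q)%N -> (H < x)%N ->
  (forall m, (0 < m)%N -> g m = divisor_sum u 0 Q m) ->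
  (forall n, (x < n <= x + h)%N -> `|f n| <= A) ->
  (forall q, (0 < q <= Q)%N -> `|u q| <= B) -> 0 <= A -> 0 <= B ->
  (forall m, (0 < m < x + h)%N -> (size (divisors m) <= V)%N) ->
  `| \sum_(1 <= a < H.+1) \sum_(x.+1 <= n < (x + h).+1) f n * g (n - a)%N
     - ((\sum_(1 <= a < H.+1) g (x - a)%N) * (\sum_(x.+1 <= n < (x + h).+1) f n)
        + (H%:R * \sum_(1 <= q < h.+1) u q / q%:R) * (\sum_(x.+1 <= n < (x + h).+1) f n)
        + (\sum_(1 <= a < H.+1) \sum_(h.+1 <= q < H.+1)
             u q * \sum_(x.+1 <= n < (x + h).+1 | n == a %[mod q]) f n)
        - (\sum_(1 <= a < H.+1) \sum_(1 <= q < H.+1 | (q %| x - a)%N) u q) * (\sum_(x.+1 <= n < (x + h).+1) f n)) |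
  <= A * B * h%:R ^+ 2 * (1 + 2 * V%:R).
Proof.
move=> hH HQ Hx gE fA uB A0 B0 dV.
set S := \sum_(x.+1 <= n < (x + h).+1) f n.
pose D := divisor_sum u.
have low n : (x < n)%N ->
  `|\sum_(1 <= a < H.+1) D 0%N h (n - a)%N - H%:R * \sum_(1 <= q < h.+1) u q / q%:R| <= B *+ h.
  move=> xn.
  have -> : \sum_(1 <= a < H.+1) D 0%N h (n - a)%N =
    \sum_(1 <= q < h.+1) u q * (\sum_(1 <= a < H.+1 | (q %| n - a)%N) 1)%N%:R.
    under eq_bigr do rewrite /D /divisor_sum big_mkcond.
    rewrite exchange_big; apply: eq_bigr => q _.
    by rewrite -big_mkcond natr_sum mulr_sumr; apply: eq_bigr => a _; rewrite mulr1.
  rewrite mulr_sumr -sumrB; apply: le_trans (ler_norm_sum _ _ _) _.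
  rewrite -[leRHS](_ : \sum_(1 <= q < h.+1) B = _); last by rewrite sumr_const_nat subn1.
  apply: ler_sum_nat => q /andP[q1 q2].
  rewrite mulrCA -mulrBr normrM -[leRHS]mulr1; apply: ler_pM => //; first by apply: uB; lia.
  by apply: dist_count_dvdn_sub_le1 => //; lia.
have high n : (x < n <= x + h)%N ->
  `|\sum_(1 <= a < H.+1) D H Q (n - a)%N - \sum_(1 <= a < H.+1) D H Q (x - a)%N|
    <= B *+ V *+ (2 * h).
  move=> xn; apply: (@le_trans _ _ (B *+ V *+ (2 * (n - x)))); last first.
    by apply: ler_wpMn2l; [exact: mulrn_wge0 | lia].
  have {1}-> : n = (x + (n - x))%N by lia.
  apply: sliding_sum_dist_le => // m mx.
  apply: le_trans (norm_divisor_sum_le _ _ uB B0) _; first by lia.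
  by apply: ler_wpMn2l => //; apply: dV; lia.
set L := (X in X - _); set E := (X in L - X).
(* The first main term minus the last keeps exactly the divisors [q > H] of [x - a], which is the
   comparison sum at [x]; the middle range cancels exactly. *)
have -> : L - E = \sum_(x.+1 <= n < (x + h).+1) f n *
   ((\sum_(1 <= a < H.+1) D 0%N h (n - a)%N - H%:R * \sum_(1 <= q < h.+1) u q / q%:R)
   + (\sum_(1 <= a < H.+1) D H Q (n - a)%N - \sum_(1 <= a < H.+1) D H Q (x - a)%N)).
  have LE : L = \sum_(x.+1 <= n < (x + h).+1) f n *
    (\sum_(1 <= a < H.+1) D 0%N h (n - a)%N + \sum_(1 <= a < H.+1) D h H (n - a)%N
      + \sum_(1 <= a < H.+1) D H Q (n - a)%N).
    rewrite /L exchange_big; apply: eq_big_nat => n nx.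
    rewrite -mulr_sumr -!big_split; congr (_ * _); apply: eq_big_nat => a aH.
    rewrite gE; last by lia.
    by rewrite (@divisor_sum_cat _ u 0 H Q) ?HQ// (@divisor_sum_cat _ u 0 h H) ?hH.
  have GE : \sum_(1 <= a < H.+1) g (x - a)%N =
    \sum_(1 <= a < H.+1) \sum_(1 <= q < H.+1 | (q %| x - a)%N) u q
      + \sum_(1 <= a < H.+1) D H Q (x - a)%N.
    rewrite -big_split; apply: eq_big_nat => a aH.
    by rewrite gE; [rewrite (@divisor_sum_cat _ u 0 H Q) ?HQ | lia].
  have ME : \sum_(1 <= a < H.+1) \sum_(h.+1 <= q < H.+1)
             u q * \sum_(x.+1 <= n < (x + h).+1 | n == a %[mod q]) f n =
    \sum_(x.+1 <= n < (x + h).+1) f n * \sum_(1 <= a < H.+1) D h H (n - a)%N.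
    under [RHS]eq_bigr do rewrite mulr_sumr.
    rewrite [RHS]exchange_big; apply: eq_big_nat => a aH.
    under [RHS]eq_bigr do rewrite /D /divisor_sum big_mkcond mulr_sumr.
    rewrite [RHS]exchange_big; apply: eq_bigr => q _.
    rewrite big_mkcond mulr_sumr; apply: eq_big_nat => n nx.
    (* The congruence becomes [q %| n - a] since [a <= H < x < n]. *)
    rewrite eqn_mod_dvd; last by lia.
    by case: ifP => _; rewrite ?mulr0// mulrC.
  rewrite LE /E GE ME; set G1 := (\sum_(1 <= a < H.+1) \sum_(1 <= q < H.+1 | _) _).
  set G2 := \sum_(1 <= a < H.+1) D H Q (x - a)%N; set W := H%:R * _.
  rewrite mulrDl -addrA.
  under eq_bigr do rewrite !mulrDr.
  under [RHS]eq_bigr do rewrite !mulrDr !mulrN.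
  rewrite !big_split/= !sumrN -!mulr_suml -/S; ring.
apply: le_trans (ler_norm_sum _ _ _) _.
rewrite -[leRHS](_ : \sum_(x.+1 <= n < (x + h).+1) A * (B *+ h + B *+ V *+ (2 * h)) = _); last first.
  rewrite sumr_const_nat; have -> : ((x + h).+1 - x.+1)%N = h by lia.
  ring.
apply: ler_sum_nat => n nx; rewrite normrM; apply: ler_pM => //; first by apply: fA; lia.
by apply: le_trans (ler_normD _ _) _; apply: lerD; [apply: low | apply: high]; lia.
Qed.

(** * Passage to powers of [x] *)

(** Compare [k]-th powers with [k > 1 / d]: then [n <= (n ^ d) ^ k], and [M <= M ^ k] lets [M]
    itself serve as the constant. *)
Lemma divisor_bound (R : realType) (d : R) : 0 < d ->
  exists2 C : R, 1 <= C &
    forall n, (0 < n)%N -> (size (divisors n))%:R <= C * n%:R `^ d.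
Proof.
move=> d0; pose k := (Num.truncn d^-1).+1.
have dk : 1 <= d * k%:R.
  by rewrite -ler_pdivrMl// mulr1 ltW// truncnS_gt.
pose M := ((k ^ k) ^ (2 ^ k))%N.
have M0 : (0 < M)%N by rewrite !expn_gt0.
exists M%:R; first by rewrite ler1n.
move=> n n0; rewrite -(@ler_pXn2r _ k)// ?nnegrE ?mulr_ge0 ?powR_ge0//.
rewrite -natrX; apply: (@le_trans _ _ (M * n)%:R).
  by rewrite ler_nat size_divisors_exp_leq.
rewrite natrM exprMn; apply: ler_pM => //.
  by rewrite -natrX ler_nat -{1}(expn1 M) leq_pexp2l.
by rewrite -powR_mulrn ?powR_ge0// -powRrM le1r_powR// ler1n.
Qed.

Lemma eqO_real_complex_nat (R : realType) (f : nat -> R[i]) (e : nat -> R) :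
  (f : nat -> R[i]^o) =O_\oo (fun n => (e n)%:C : R[i]^o) ->
  exists2 c : R, 0 <= c &
    exists N, forall n, (N <= n)%N -> `|f n| <= (c * `|e n|)%:C.
Proof.
move=> /eqO_exP[k k0 [N _ fN]].
(* A positive complex number is real, so the implied constant descends to [R]. *)
have kR : (complex.Re k)%:C = k by apply: RRe_real; rewrite gtr0_real.
exists (complex.Re k); first by rewrite -ler0c kR ltW.
exists N => n /fN /=; rewrite -{1}kR => fn; apply: le_trans fn _.
rewrite rmorphM /= ler_wpM2l//; first by rewrite ler0c -ler0c kR ltW.
by rewrite normc_def/= expr0n/= addr0 sqrtr_sqr.
Qed.

Unset Implicit Arguments.

(** [C] is chosen before [h], [H], [Q] and [g], so it depends only on [f], [K] and [eps]; only the
    threshold for [x] may depend on the rest. *)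
Theorem theorem2 (R : realType) (f : nat -> R[i])
  (hf : essentially_bounded f) (K : R -> R) (eps : R) (heps : 0 < eps) :
  exists C : R, forall (h H Q : nat -> nat) (g : nat -> nat -> R[i]),
    (forall x, (0 < x)%N -> (0 < h x)%N /\ (h x <= H x < Q x)%N) ->
    (fun x => (Q x)%:R : R) =O_\oo (fun x => x%:R : R) ->
    (fun x => (H x)%:R : R) =o_\oo (fun x => x%:R : R) ->
    (forall x, (0 < x)%N -> sieve_function K (Q x) (g x)) ->
    \forall x \near \oo,
      `| \sum_(1 <= a < (H x).+1) \sum_(x.+1 <= n < (x + h x).+1)
            f n * g x (n - a)%N
         - ((\sum_(1 <= a < (H x).+1) g x (x - a)%N)
              * (\sum_(x.+1 <= n < (x + h x).+1) f n)
            + ((H x)%:R * \sum_(1 <= q < (h x).+1) eratosthenes (g x) q / q%:R)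
              * (\sum_(x.+1 <= n < (x + h x).+1) f n)
            + (\sum_(1 <= a < (H x).+1) \sum_((h x).+1 <= q < (H x).+1)
                 eratosthenes (g x) q
                 * \sum_(x.+1 <= n < (x + h x).+1 | n == a %[mod q]) f n)
            - (\sum_(1 <= a < (H x).+1)
                 \sum_(1 <= q < (H x).+1 | (q %| x - a)%N)
                   eratosthenes (g x) q)
              * (\sum_(x.+1 <= n < (x + h x).+1) f n)) |
      <= (C * x%:R `^ eps * (h x)%:R ^+ 2)%:C.
Proof.
(* Three quantities, [f], the transform of [g] and the divisor count, are each bounded at arguments
   up to [x ^ 2], costing [x ^ (2 * d)] apiece. *)
pose d := eps / 6; have d0 : 0 < d by rewrite divr_gt0.
have [cf cf0 [N fN]] := eqO_real_complex_nat (hf d d0).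
have [cd cd1 divN] := divisor_bound d0.
(* The 3 absorbs [1 + 2 * V], and the absolute value makes the constant nonnegative whatever the
   sign of [K d]. *)
exists (3 * cf * `|K d| * cd) => h H Q g hHQ /eqO_exP[cQ cQ0 QO] /eqoP Ho gS.
near=> x.
have x2 : (1 < x)%N by near: x; exact: nbhs_infty_gt.
have x0 : (0 < x)%N by lia.
have [h0 /andP[hH HQ]] := hHQ x x0.
have Hx : (H x < x)%N.
  (* Any constant below 1 would do; [H x < x] keeps [x - a] and [n - a] positive. *)
  have : `|(H x)%:R| <= 2^-1 * `|x%:R| :> R by near: x; apply: Ho.
  rewrite !normr_nat -(ltr_nat R) => /le_lt_trans; apply.
  have : 0 < x%:R :> R by rewrite ltr0n.
  lra.
(* Once [x >= cQ], the bound [cQ * x] is at most [x ^ 2]; this crude form keeps [cQ] out of [C]. *)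
have Qx : (Q x <= x * x)%N.
  have : `|(Q x)%:R| <= cQ * `|x%:R| :> R by near: x.
  rewrite !normr_nat -(ler_nat R) natrM => /le_trans; apply.
  by apply: ler_wpM2r => //; near: x; exact: nbhs_infty_ger.
have [gE _ gK] := gS x x0.
pose X : R := x%:R `^ d.
have X0 : 0 <= X by apply: powR_ge0.
have X1 : 1 <= X by rewrite -(powRr0 x%:R) ler_powR// ?ler1n// ltW.
have leX m : (m <= x * x)%N -> m%:R `^ d <= X ^+ 2.
  move=> mx; rewrite expr2 -powRM// -natrM.
  by apply: ge0_ler_powR; rewrite ?nnegrE ?ler_nat// ltW.
have xh : (x + h x <= x * x)%N by nia.
(* The divisor count is an integer, so its real bound may be rounded down. *)
pose V := Num.truncn (cd * X ^+ 2).
have cd0 : 0 <= cd by lra.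
have cX0 : 0 <= cd * X ^+ 2 by rewrite mulr_ge0// exprn_ge0.
have VX : V%:R <= cd * X ^+ 2 by have /andP[] := truncn_itv cX0.
have cX1 : 1 <= cd * X ^+ 2 by rewrite mulr_ege1// exprn_ege1.
apply: le_trans (@sieve_correlation_bound _ f (g x) (eratosthenes (g x)) x (h x) (H x)
  (Q x) V (cf * X ^+ 2)%:C (`|K d| * X ^+ 2)%:C _ _ _ _ _ _ _ _ _) _ => //.
- exact: ltnW.
- move=> n xn; apply: le_trans (fN n _) _.
    have : (N <= x)%N by near: x; exact: nbhs_infty_ge.
    lia.
  by rewrite lecR ler_wpM2l// ger0_norm ?powR_ge0// leX//; lia.
- move=> q qQ; apply: le_trans (gK d d0 q _) _; first by lia.
  rewrite lecR; apply: (@le_trans _ _ (`|K d| * q%:R `^ d)).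
    by rewrite ler_wpM2r ?powR_ge0// ler_norm.
  by rewrite ler_wpM2l// leX//; lia.
- by rewrite ler0c mulr_ge0// exprn_ge0.
- by rewrite ler0c mulr_ge0// exprn_ge0.
- move=> m mx; rewrite truncn_ge_nat//; apply: le_trans (divN m _) _; first by lia.
  by rewrite ler_wpM2l// leX//; lia.
have -> : x%:R `^ eps = X ^+ 6.
  by rewrite -powR_mulrn// -powRrM /d divfK.
have toC (a b : R) (m n : nat) :
    a%:C * b%:C * m%:R ^+ 2 * (1 + 2 * n%:R) = (a * b * m%:R ^+ 2 * (1 + 2 * n%:R))%:C.
  by rewrite !expr2 !rmorphM/= rmorphD/= !rmorphM/= !rmorph_nat.
rewrite toC lecR.
have -> : 3 * cf * `|K d| * cd * X ^+ 6 * (h x)%:R ^+ 2 =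
   (cf * X ^+ 2) * (`|K d| * X ^+ 2) * (h x)%:R ^+ 2 * (3 * (cd * X ^+ 2)) by ring.
apply: ler_wpM2l; last by lra.
by rewrite !mulr_ge0// exprn_ge0.
Unshelve. all: by end_near.
Qed.
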